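(* Let $D_1$ and $D_2$ be symplectic difference sets in groups $G_1$ and $G_2$, respectively. Let $\phi : G_2 \to \mathrm{Aut}(G_1)$ be a homomorphism and let $G = G_1 \rtimes_\phi G_2$. Let $D = \big(D_1 \times (G_2 - D_2)\big) \cup \big((G_1 - D_1) \times D_2\big)$, viewed as a subset of the common underlying set $G_1 \times G_2$. If $(g_i, g_j) * D = (g_i, g_j) \cdot D$ for all $(g_i, g_j) \in G_1 \times G_2$, where $*$ denotes the multiplication of $G_1 \rtimes_\phi G_2$ and $\cdot$ denotes the multiplication of the direct product $G_1 \times G_2$, then $D$ is a symplectic difference set in $G_1 \rtimes_\phi G_2$.
   Context: A $(v,k,\lambda)$ difference set in a group $G$ of order $v$ is a subset $D$ of size $k$ such that the multiset $\{d_1 d_2^{-1} : d_1,d_2 \in D\}$ contains every non-identity element of $G$ exactly $\lambda$ times. Its development is the symmetric design with points the elements of $G$, blocks the left translates $gD$ ($g\in G$), incidence by membership. Two symmetric designs with incidence matrices $A_1, A_2$ are isomorphic iff $A_1 = P A_2 Q$ for some permutation matrices $P, Q$. The symplectic design on $2^{2n}$ points is the design with incidence matrix $A = -\tfrac12\big((J_4 - 2I_4)^{\otimes n} - J\big)$, where $\otimes$ is the Kronecker product, $I_4$, $J_4$ are the $4\times 4$ identity and all-ones matrices and $J$ is the $4^n \times 4^n$ all-ones matrix. A symplectic difference set is a difference set (in a group of order $2^{2n}$) whose development is isomorphic to the symplectic design on $2^{2n}$ points. For a homomorphism $\phi: H \to \mathrm{Aut}(N)$, the semi-direct product $N \rtimes_\phi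 H$ has underlying set $N \times H$ and multiplication $(n_1,h_1)(n_2,h_2) = (n_1 \phi(h_1)(n_2), h_1 h_2)$. For $r$ in a group and a subset $D$, $rD$ denotes $\{rd : d \in D\}$ computed with the indicated multiplication. *)

(* Defs.v *)
From HB Require Import structures.
From mathcomp Require Import all_boot all_algebra all_fingroup.
From mathcomp Require Export mxtens.

Set Implicit Arguments.
Unset Strict Implicit.
Unset Printing Implicit Defensive.

Import GRing.Theory.
Local Open Scope group_scope.

Definition difference_set (gT : finGroupType) (v k lambda : nat)
    (D : {set gT}) : Prop :=
  [/\ #|gT| = v, #|D| = k &
      forall g : gT, g != 1 ->
        #|[set d in setX D D | d.1 * d.2^-1 == g]| = lambda].

(* The group is explicit because below the same set carries two group laws. *)
Definition left_translate (gT : finGroupType) (g : gT) (D : {set gT}) :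
    {set gT} :=
  [set g * d | d in D].
Arguments left_translate : clear implicits.

(* Rows are the points x : gT, columns the left translates of D, both listed
   in the order of enum gT. *)
Definition development_mx (gT : finGroupType) (D : {set gT}) :
    'M[rat]_#|gT| :=
  (\matrix_(i, j) (enum_val i \in left_translate gT (enum_val j) D)%:R)%R.

(* The cast only identifies the propositionally equal sizes m1 and m2. *)
Definition isomorphic_mx (m1 m2 : nat) (A1 : 'M[rat]_m1) (A2 : 'M[rat]_m2) :
    Prop :=
  exists (e : m1 = m2) (P Q : 'M[rat]_m2),
    [/\ is_perm_mx P, is_perm_mx Q & castmx (e, e) A1 = (P *m A2 *m Q)%R].

(* _ ^t n is the n-fold Kronecker power. *)
Definition symplectic_mx (n : nat) : 'M[rat]_(4 ^ n) :=
  (- 2^-1 *: ((const_mx 1 - 2 *: 1%:M : 'M[rat]_4) ^t n - const_mx 1))%R.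

Definition symplectic_difference_set (gT : finGroupType) (D : {set gT}) :
    Prop :=
  exists n : nat,
    (exists k lambda : nat, difference_set (2 ^ (2 * n)) k lambda D) /\
    isomorphic_mx (development_mx D) (symplectic_mx n).
Arguments symplectic_difference_set : clear implicits.

(* Homomorphisms H -> Aut(N), where Aut(N) is the set of automorphisms of the
   whole group N and its product is composition of functions,
   phi (h1 h2) = phi h1 \o phi h2.  The product of {perm N} composes in the
   opposite order, so such a phi is not a {morphism [set: H] >-> {perm N}}. *)
Record aut_hom (H N : finGroupType) := AutHom {
  aut_hom_fun :> H -> {perm N};
  aut_hom_Aut : forall h : H, aut_hom_fun h \in Aut [set: N];
  aut_homM : forall (h1 h2 : H) (n : N),
    aut_hom_fun (h1 * h2) n = aut_hom_fun h1 (aut_hom_fun h2 n)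
}.

(* The library's sdprod_by uses right actions and H * N as underlying set, with
   a different multiplication; here the underlying set is that of N * H. *)
Definition sdprodl (N H : finGroupType) (phi : aut_hom H N) : Type :=
  (N * H)%type.

HB.instance Definition _ (N H : finGroupType) (phi : aut_hom H N) :=
  Finite.copy (sdprodl phi) (N * H)%type.

Section SemiDirectProduct.
Variables (N H : finGroupType) (phi : aut_hom H N).
Implicit Types x y z : sdprodl phi.

Definition sdprodl_one : sdprodl phi := (1, 1).
Definition sdprodl_mul x y : sdprodl phi := (x.1 * phi x.2 y.1, x.2 * y.2).
Definition sdprodl_inv x : sdprodl phi := (phi x.2^-1 x.1^-1, x.2^-1).

Lemma aut_hom_morph (h : H) : {morph phi h : n1 n2 / n1 * n2}.
Proof.
move=> n1 n2; have /morphicP phiM := Aut_morphic (aut_hom_Aut phi h).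
by rewrite phiM ?inE.
Qed.

Lemma aut_hom1 (n : N) : phi 1 n = n.
Proof. by apply: (@perm_inj _ (phi 1)); rewrite -aut_homM mulg1. Qed.

Lemma sdprodl_mulgA : associative sdprodl_mul.
Proof.
by move=> x y z; rewrite /sdprodl_mul /= aut_hom_morph aut_homM !mulgA.
Qed.

Lemma sdprodl_mul1g : left_id sdprodl_one sdprodl_mul.
Proof. by case=> n h; rewrite /sdprodl_mul /= aut_hom1 !mul1g. Qed.

Lemma sdprodl_mulVg : left_inverse sdprodl_one sdprodl_inv sdprodl_mul.
Proof.
case=> n h; rewrite /sdprodl_mul /= -aut_hom_morph !mulVg.
suff -> : phi h^-1 1 = 1 by [].
by apply: (mulgI (phi h^-1 1)); rewrite -aut_hom_morph !mulg1.
Qed.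

HB.instance Definition _ := Finite_isGroup.Build (sdprodl phi)
  sdprodl_mulgA sdprodl_mul1g sdprodl_mulVg.

End SemiDirectProduct.

Definition product_set (G1 G2 : finGroupType) (D1 : {set G1}) (D2 : {set G2}) :
    {set G1 * G2} :=
  setX D1 (~: D2) :|: setX (~: D1) D2.

(* Main.v *)
(* Replacing incidence 0/1 by the sign 1/-1, i.e. A by J - 2A, turns the symplectic
   design into the Kronecker power (J_4 - 2I_4)^{(x)n}, and the symmetric
   difference of D_1 x G_2 and G_1 x D_2 into the product of signs; so the
   development of D in the direct product is the Kronecker product of those of
   D_1 and D_2.  By hypothesis the semidirect product has the same translates.
   Finally (J_4 - 2I_4)^2 = 4I_4 makes distinct columns of signs orthogonal, so
   that v - 4k + 4 |gD \cap D| = 0 for g <> 1, which is the difference set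
   property. *)
Require Import Defs.
From mathcomp Require Import all_boot all_algebra all_fingroup.
From mathcomp Require Import ring lra.

Set Implicit Arguments.
Unset Strict Implicit.
Unset Printing Implicit Defensive.

Import GRing.Theory Num.Theory.
Local Open Scope ring_scope.

(** Hiding the index encoding behind a bijection avoids casts between matrix sizes. Exponent 1 is a
    separate case because [A ^t 1] is [A] itself, with no trailing factor of size 1. *)
Lemma ntensmx_recE (R : pzRingType) m (A : 'M[R]_m) k :
  exists2 f : 'I_m * 'I_(m ^ k) -> 'I_(m ^ k.+1), bijective f &
    forall i j i' j', (A ^t k.+1) (f (i, i')) (f (j, j')) =
                      A i j * (A ^t k) i' j'.
Proof.
case: k => [|k].
  exists fst; last by move=> i j i' j'; rewrite ntensmx1 ntensmx0 !ord1 mxE mulr1.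
  by exists (pair^~ ord0) => [[i i']|//]; rewrite [i']ord1.
exists (@mxtens_index _ _).
  exists (@mxtens_unindex _ _); first exact: mxtens_indexK.
  exact: mxtens_unindexK.
by move=> i j i' j'; rewrite ntensmxSS tensmxE.
Qed.

Lemma ntensmxD (R : pzRingType) m (A : 'M[R]_m) k l :
  exists2 f : 'I_(m ^ k) * 'I_(m ^ l) -> 'I_(m ^ (k + l)), bijective f &
    forall i j i' j', (A ^t (k + l)) (f (i, i')) (f (j, j')) =
                      (A ^t k) i j * (A ^t l) i' j'.
Proof.
elim: k => [|k [f [f' fK f'K] fE]].
  exists snd; last by move=> i j i' j'; rewrite ntensmx0 !ord1 mxE mul1r.
  by exists (pair ord0) => [[i i']|//]; rewrite [i]ord1.
have [g [g' gK g'K] gE] := ntensmx_recE A k.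
have [h [h' hK h'K] hE] := ntensmx_recE A (k + l).
(* Reassociation: [g'] splits off the first tensor factor, [f] merges the remaining ones with the
   second power, and [h] puts the first factor back. *)
exists (fun p => let q := g' p.1 in h (q.1, f (q.2, p.2))).
  exists (fun r => let q := h' r in let p := f' q.2 in (g (q.1, p.1), p.2)).
    by case=> i i' /=; rewrite hK fK /= -surjective_pairing g'K.
  by move=> r /=; rewrite gK /= -surjective_pairing f'K -surjective_pairing h'K.
move=> i j i' j' /=; rewrite hE fE -[in RHS](g'K i) -[in RHS](g'K j).
by case: (g' i) (g' j) => [? ?] [? ?] /=; rewrite gE mulrA.
Qed.

Local Notation K := (const_mx 1 - 2 *: 1%:M : 'M[rat]_4).

Lemma ntens_orthogonal (R : comPzRingType) m (A : 'M[R]_m) c k :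
  A^T *m A = c%:M -> (A ^t k)^T *m A ^t k = (c ^+ k)%:M.
Proof.
move=> AA; apply/matrixP; elim: k => [|k IHk] i j.
  by rewrite ntensmx0 trmx1 mul1mx.
have [f [f' fK f'K] fE] := ntensmx_recE A k.
rewrite -(f'K i) -(f'K j); case: (f' i) (f' j) => [i1 i2] [j1 j2] {i j}.
rewrite mxE (reindex f) /=; last by exists f' => ? _.
have := IHk i2 j2; have /matrixP/(_ i1 j1) := AA; rewrite !mxE => E1 E2.
(* The Kronecker delta of two pairs is the product of the deltas of their components, so both sides
   factor. *)
rewrite (can_eq fK) xpair_eqE -mulnb -mulr_natr natrM exprS mulrACA !mulr_natr.
rewrite -E1 -E2 big_distrlr pair_big /=.
by apply: eq_bigr => -[x y] _; rewrite !mxE !fE mulrACA.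
Qed.

Lemma K_orthogonal : K^T *m K = 4%:M.
Proof.
apply/matrixP=> i j; rewrite !mxE !big_ord_recl big_ord0 !mxE /=.
by case: i j => -[|[|[|[|//]]]] ? [[|[|[|[|//]]]] ?].
Qed.


Definition sign_dev (gT : finGroupType) (D : {set gT}) (x g : gT) : rat :=
  (-1) ^+ (x \in left_translate gT g D).

Lemma bool_sign (b : bool) (s : rat) :
  b%:R = - 2^-1 * (s - 1) <-> (-1) ^+ b = s.
Proof.
have -> : (-1) ^+ b = 1 - 2 * b%:R :> rat by case: b.
by split=> [->|<-]; field.
Qed.

(** Trades permutation matrices and the size cast for labellings of points and blocks, and
    incidences for signs, in which form Kronecker products are easy to compare. *)
Lemma isomorphic_symplecticP (gT : finGroupType) (D : {set gT}) n :
  isomorphic_mx (development_mx D) (symplectic_mx n) <->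
  exists a b : gT -> 'I_(4 ^ n), [/\ bijective a, bijective b &
    forall x g, sign_dev D x g = (K ^t n) (a x) (b g)].
Proof.
split=> [[e [_ [_ [/is_perm_mxP[s ->] /is_perm_mxP[t ->] E]]]]|].
  exists (fun x => s (cast_ord e (enum_rank x))).
  (* The inverse appears since right multiplication by [perm_mx t] moves column [t^-1 j] to place
     [j]. *)
  exists (fun g => t^-1%g (cast_ord e (enum_rank g))).
  have bij (u : 'S_(4 ^ n)) :
      bijective (fun x : gT => u (cast_ord e (enum_rank x))).
    exists (fun i => enum_val (cast_ord (esym e) (u^-1%g i))) => i.
      by rewrite permK cast_ordK enum_rankK.
    by rewrite enum_valK cast_ordKV permKV.
  split=> // x g; apply/bool_sign.
  move/matrixP/(_ (cast_ord e (enum_rank x)) (cast_ord e (enum_rank g))): E.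
  rewrite castmxE mxE !cast_ordK !enum_rankK => ->.
  by rewrite -row_permE -[t]invgK -col_permE invgK !mxE.
move=> [a [b [a_bij b_bij E]]].
have e : #|gT| = (4 ^ n)%N by rewrite (bij_eq_card a_bij) card_ord.
pose val (i : 'I_(4 ^ n)) : gT := enum_val (cast_ord (esym e) i).
have val_inj : injective val by move=> i j /enum_val_inj/cast_ord_inj.
exists e, (perm_mx (perm (inj_comp (bij_inj a_bij) val_inj))).
exists (perm_mx (perm (inj_comp (bij_inj b_bij) val_inj))^-1%g).
split; try exact: perm_mx_is_perm.
apply/matrixP=> i j; rewrite -row_permE -col_permE castmxE !mxE !permE /=.
by apply/bool_sign; apply: E.
Qed.

Lemma mem_left_translate (gT : finGroupType) (g : gT) (D : {set gT}) x :
  (x \in left_translate gT g D) = ((g^-1 * x)%g \in D).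
Proof.
apply/imsetP/idP => [[d Dd ->]|Dx]; first by rewrite mulKg.
by exists (g^-1 * x)%g; rewrite // mulKVg.
Qed.

Lemma sign_dev_product (G1 G2 : finGroupType) (D1 : {set G1}) (D2 : {set G2})
    (x g : G1 * G2) :
  sign_dev (product_set D1 D2) x g =
  sign_dev D1 x.1 g.1 * sign_dev D2 x.2 g.2.
Proof.
rewrite /sign_dev !mem_left_translate !inE /=.
by case: (_ \in D1); case: (_ \in D2); rewrite ?expr0 ?expr1 ?mulrNN ?mulr1
  ?mul1r.
Qed.

Lemma sum_sign (T : finType) (A B : {set T}) :
  \sum_x (-1) ^+ (x \in A) * (-1) ^+ (x \in B) =
  #|T|%:R - 2 * #|A|%:R - 2 * #|B|%:R + 4 * #|A :&: B|%:R :> rat.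
Proof.
rewrite -!sum1_card !natr_sum !(big_mkcond (fun x => x \in _)) !mulr_sumr.
rewrite -!sumrB -big_split; apply: eq_bigr => x _; rewrite inE.
by case: (x \in A); case: (x \in B).
Qed.

Lemma card_left_translate (gT : finGroupType) (g : gT) (D : {set gT}) :
  #|left_translate gT g D| = #|D|.
Proof. exact: card_imset (mulgI g). Qed.

(** The first entry [x] of such a pair forces the second to be [g^-1 * x], which lies in [D] exactly
    when [x] lies in [gD]. *)
Lemma card_quotients (gT : finGroupType) (g : gT) (D : {set gT}) :
  #|[set d in setX D D | d.1 * d.2^-1 == g]%g| = #|left_translate gT g D :&: D|.
Proof.
have f_inj : injective (fun x : gT => (x, g^-1 * x)%g) by move=> x y [].
rewrite -(card_imset _ f_inj); apply: eq_card => -[x y]; rewrite !inE /=.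
apply/andP/imsetP => [[/andP[Dx Dy] /eqP<-]|[z]].
  by exists x; rewrite ?inE ?mem_left_translate invMg invgK mulgKV ?Dx ?Dy.
rewrite !inE mem_left_translate => /andP[Dgz Dz] [-> ->].
by rewrite Dgz Dz invMg invgK mulKVg.
Qed.

Lemma sign_dev_orthogonal (gT : finGroupType) (D : {set gT}) n :
  isomorphic_mx (development_mx D) (symplectic_mx n) ->
  forall g h, g != h -> \sum_x sign_dev D x g * sign_dev D x h = 0.
Proof.
case/isomorphic_symplecticP=> a [b [a_bij b_bij E]] g h gh.
have /matrixP/(_ (b g) (b h)) := ntens_orthogonal n K_orthogonal.
rewrite !mxE (bij_eq b_bij) (negPf gh) mulr0n; apply: etrans.
rewrite (reindex a); last exact: onW_bij.
by apply: eq_bigr => x _; rewrite !E mxE.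
Qed.

(** The isomorphism alone yields the difference set property, by orthogonality of the sign columns
    of [g] and [1]. *)
Lemma symplectic_difference_setP (gT : finGroupType) (D : {set gT}) n :
  isomorphic_mx (development_mx D) (symplectic_mx n) ->
  symplectic_difference_set gT D.
Proof.
move=> iso; exists n; split=> //.
have [e _] := iso.
(* This solves v - 4k + 4 lambda = 0 for lambda; the equation [E] below shows that the subtraction
   does not truncate and the division is exact. *)
exists #|D|, ((4 * #|D| - #|gT|) %/ 4)%N; split=> // [|g g1].
  by rewrite e expnM.
have := sign_dev_orthogonal iso g1; rewrite sum_sign !card_left_translate.
have -> : left_translate gT 1%g D = D.
  by apply/setP=> x; rewrite mem_left_translate invg1 mul1g.
rewrite card_quotients => E.
have {}E : (4 * #|left_translate gT g D :&: D| + #|gT| = 4 * #|D|)%N.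
  apply/eqP; rewrite -(eqr_nat rat) natrD !natrM; apply/eqP; lra.
by rewrite -E addnK mulKn.
Qed.

Theorem theorem4p1 (G1 G2 : finGroupType) (D1 : {set G1}) (D2 : {set G2})
    (phi : aut_hom G2 G1) :
  symplectic_difference_set G1 D1 ->
  symplectic_difference_set G2 D2 ->
  (forall (gi : G1) (gj : G2),
     left_translate (sdprodl phi) (gi, gj) (product_set D1 D2)
     = left_translate (G1 * G2)%type (gi, gj) (product_set D1 D2)) ->
  symplectic_difference_set (sdprodl phi) (product_set D1 D2).
Proof.
move=> [n1 [_ /isomorphic_symplecticP[a1 [b1 [a1_bij b1_bij E1]]]]].
move=> [n2 [_ /isomorphic_symplecticP[a2 [b2 [a2_bij b2_bij E2]]]]] eqD.
have [f f_bij fE] := ntensmxD K n1 n2.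
have bij (c1 : G1 -> _) (c2 : G2 -> _) : bijective c1 -> bijective c2 ->
    bijective (fun x : sdprodl phi => f (c1 x.1, c2 x.2)).
  move=> [d1 c1K d1K] [d2 c2K d2K]; case: f_bij => f' fK f'K.
  exists (fun i => (d1 (f' i).1, d2 (f' i).2)) => [[x y]|i] /=.
    by rewrite fK /= c1K c2K.
  by rewrite d1K d2K -surjective_pairing f'K.
apply/(@symplectic_difference_setP _ _ (n1 + n2))/isomorphic_symplecticP.
exists (fun x => f (a1 x.1, a2 x.2)), (fun x => f (b1 x.1, b2 x.2)).
split; [exact: bij | exact: bij |].
(* The product of signs is the sign for the direct product; [eqD] carries it over to the semidirect
   one. *)
move=> x [gi gj]; rewrite fE -E1 -E2 -(sign_dev_product D1 D2 x (gi, gj)).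
by rewrite /sign_dev eqD.
Qed.
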